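(* Fix a constant $\kappa>0$. Given any two oriented points $X$ and $Y$ in $T\mathbb{R}^2$ such that $X\neq Y$, if the shortest curvature-bounded path $\gamma_m$ from $X$ to $Y$ takes a geometric pattern of $\mathrm{C}_\eta\mathrm{C}_\zeta\mathrm{C}_\xi$, then for any $s\geq\ell_m$ there exists a curvature-bounded path $\gamma\in\Gamma(X,Y)$ such that $s=\ell(\gamma)$.
   Context: An oriented point is an element $X=(\boldsymbol{x},\boldsymbol{v})$ of the tangent bundle $T\mathbb{R}^2$, where $\boldsymbol{x}$ is a point in $\mathbb{R}^2$ and $\boldsymbol{v}$ is a tangent vector to $\mathbb{R}^2$ at $\boldsymbol{x}$ (of unit length, as the arc-length parameterisation below requires). A curvature-bounded path from $X=(\boldsymbol{x},\boldsymbol{v})$ to $Y=(\boldsymbol{y},\boldsymbol{w})$ is a map $\gamma:[0,s]\to\mathbb{R}^2$ that is $C^1$ and piecewise $C^2$, parameterised by arc length ($\|\gamma'(t)\|=1$ for all $t\in[0,s]$), with $\gamma(0)=\boldsymbol{x}$, $\gamma'(0)=\boldsymbol{v}$, $\gamma(s)=\boldsymbol{y}$, $\gamma'(s)=\boldsymbol{w}$, and $\|\gamma''(t)\|\leq\kappa$ for all $t\in[0,s]$ where $\gamma''(t)$ is defined. For $X\neq Y$, $\Gamma(X,Y)$ denotes the space of all curvature-bounded paths from $X$ to $Y$, and $\ell(\gamma)$ denotes the length of $\gamma\in\Gamma(X,Y)$. $\gamma_m$ denotes the shortest curvature-bounded path from $X$ to $Y$, and $\ell_m=\ell(\gamma_m)>0$.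 $\mathrm{C}$ denotes a circular arc of radius $1/\kappa$, and $\mathrm{C}_\eta$ denotes such an arc with radian $\eta\geq 0$. $\mathrm{R}$ (resp. $\mathrm{L}$) means that the arc has a right-turning (resp. left-turning) direction. The pattern $\mathrm{CCC}$ stands for $\{\mathrm{RLR},\mathrm{LRL}\}$, i.e. a concatenation of three such arcs with alternating turning directions, and $\mathrm{C}_\eta\mathrm{C}_\zeta\mathrm{C}_\xi$ is the same pattern with the radians $\eta,\zeta,\xi$ of the three arcs indicated. (The shortest curvature-bounded path between two oriented points is always of pattern $\mathrm{CCC}$, or $\mathrm{CSC}$ with $\mathrm{S}$ a straight line segment, or a substring of one of these.) *)

(* Defs.v *)
From Stdlib Require Import Reals.
From Coquelicot Require Import Coquelicot.
Open Scope R_scope.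

(* Coquelicot's [norm] on [R * R] is the Euclidean one. *)
Definition plane : Type := (R * R)%type.

(* T R^2 = R^2 x R^2: base point, then tangent vector. *)
Definition tangent : Type := (plane * plane)%type.

Definition oriented_point (X : tangent) : Prop := norm (snd X) = 1.

Definition itv (a b : R) : R -> Prop := fun t => a <= t <= b.

(* Derivative relative to [D]: one-sided at an endpoint of [D] when [D] is an
   interval. It is unique because [D] is only ever a nondegenerate interval. *)
Definition is_derive_in (D : R -> Prop) (f : R -> plane) (t : R) (v : plane) : Prop :=
  filterdiff f (within D (locally t)) (fun h : R => scal h v).

Definition C1_with (a b : R) (f f' : R -> plane) : Prop :=
  (forall t, itv a b t -> is_derive_in (itv a b) f t (f' t)) /\
  continuous_on (itv a b) f'.

(* For [f] of class C^1 on [a, b] with derivative [f'], this says that [f] is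
   C^2 on each closed piece of some finite subdivision of [a, b]. *)
Definition piecewise_C1 (a b : R) (f' : R -> plane) : Prop :=
  exists (n : nat) (tau : nat -> R),
    tau 0%nat = a /\ tau (S n) = b /\
    forall i : nat, (i <= n)%nat ->
      tau i < tau (S i) /\
      exists f'' : R -> plane, C1_with (tau i) (tau (S i)) f' f''.

(* The curvature-bounded paths from [X] to [Y]. Only the restrictions of [path]
   and [vel] to [0, dom_end] matter, and there [vel] is determined by [path].
   The domain is nondegenerate: a derivative at 0 relative to {0} would be
   arbitrary, and for X <> Y no path has domain {0}. *)
Record Gamma (kappa : R) (X Y : tangent) : Type := {
  dom_end : R;
  path : R -> plane;
  vel : R -> plane;
  dom_end_pos : 0 < dom_end;
  path_C1 : C1_with 0 dom_end path vel;
  path_pw_C2 : piecewise_C1 0 dom_end vel;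
  path_arclength : forall t, itv 0 dom_end t -> norm (vel t) = 1;
  path_start : path 0 = fst X;
  vel_start : vel 0 = snd X;
  path_end : path dom_end = fst Y;
  vel_end : vel dom_end = snd Y;
  path_curvature : forall (t : R) (a : plane), itv 0 dom_end t ->
    is_derive_in (itv 0 dom_end) vel t a -> norm a <= kappa
}.

Arguments dom_end {kappa X Y} _.
Arguments path {kappa X Y} _ _.
Arguments vel {kappa X Y} _ _.

Definition len {kappa : R} {X Y : tangent} (g : Gamma kappa X Y) : R :=
  RInt (fun t => norm (vel g t)) 0 (dom_end g).

Definition shortest {kappa : R} {X Y : tangent} (g : Gamma kappa X Y) : Prop :=
  forall h : Gamma kappa X Y, len g <= len h.

Inductive turn : Type := Lft | Rgt.

Definition opp_turn (d : turn) : turn :=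
  match d with Lft => Rgt | Rgt => Lft end.

(* Left-turning is counterclockwise. *)
Definition turn_sign (d : turn) : R :=
  match d with Lft => 1 | Rgt => -1 end.

(* From parameter [a] on, [f] runs at unit speed along an arc of radius
   1 / kappa and radian [eta], hence up to parameter a + eta / kappa. *)
Definition is_arc (kappa : R) (d : turn) (f : R -> plane) (a eta : R) : Prop :=
  exists (c : plane) (phi : R), forall t, itv a (a + eta / kappa) t ->
    f t = (fst c + / kappa * cos (phi + turn_sign d * (kappa * (t - a))),
           snd c + / kappa * sin (phi + turn_sign d * (kappa * (t - a)))).

(* All three arcs are nondegenerate: a path made of fewer arcs has a substring
   of the pattern CCC as its pattern, not CCC itself. *)
Definition CCC {kappa : R} {X Y : tangent} (g : Gamma kappa X Y)
    (eta zeta xi : R) : Prop :=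
  0 < eta /\ 0 < zeta /\ 0 < xi /\
  dom_end g = (eta + zeta + xi) / kappa /\
  exists d : turn,
    is_arc kappa d (path g) 0 eta /\
    is_arc kappa (opp_turn d) (path g) (eta / kappa) zeta /\
    is_arc kappa d (path g) ((eta + zeta) / kappa) xi.

(* Main.v *)
Require Import Defs.
From Stdlib Require Import Reals Lra Lia List.
From Coquelicot Require Import Coquelicot.
Import ListNotations.
Open Scope R_scope.

(* If the middle arc turns by more than PI, it contains two antiparallel
   tangents; inserting a segment of length e/2 at each of these two points does
   not move the end of the path and lengthens it by e, for any e > 0.

   If the middle arc turns by at most PI, the path is not shortest. Remove an
   arc of small length a from the end of the first arc, from both ends of the
   middle arc, and from the beginning of the third arc, and insert a segment at
   the midpoint of the middle arc. The endpoint is unchanged for the segment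
   length d = 4/kappa * (sin (kappa q/2) - sin (kappa (q/2 - a))), where q is
   the length of the middle arc, and 0 < d < 4a because sin is increasing on
   [0, PI/2] and strictly 1-Lipschitz. *)

(** * Norms and relative derivatives in the plane *)

Notation plane_module := (prod_NormedModule R_AbsRing R_NormedModule R_NormedModule).

Lemma norm_plane (p : plane) : norm p = sqrt (fst p ^ 2 + snd p ^ 2).
Proof.
change (norm p) with (sqrt (Rabs (fst p) ^ 2 + Rabs (snd p) ^ 2)).
now rewrite !pow2_abs.
Qed.

Lemma norm_plane_le (p : plane) (r : R) :
  0 <= r -> fst p ^ 2 + snd p ^ 2 <= r ^ 2 -> norm p <= r.
Proof.
intros Hr H.
rewrite norm_plane, <- (sqrt_pow2 r Hr).
now apply sqrt_le_1_alt.
Qed.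

Lemma norm_plane_scal (h : R) (p : plane) : norm (scal h p : plane) = Rabs h * norm p.
Proof.
rewrite !norm_plane.
change (sqrt ((h * fst p) ^ 2 + (h * snd p) ^ 2)
        = Rabs h * sqrt (fst p ^ 2 + snd p ^ 2)).
rewrite <- (sqrt_pow2 (Rabs h)) by apply Rabs_pos.
rewrite <- sqrt_mult, pow2_abs; [f_equal; ring | apply pow2_ge_0 |].
apply Rplus_le_le_0_compat; apply pow2_ge_0.
Qed.

(** [filterdiff] quantifies over all limits of the filter. Since [t] is in [D], it belongs to every
    set of the filter, so a limit [x] other than [t] is excluded by the ball of radius |t - x|
    around it. *)
Lemma is_derive_in_iff (D : R -> Prop) (f : R -> plane) (t : R) (v : plane) :
  D t ->
  (is_derive_in D f t v <->
   forall eps : posreal, exists delta : posreal, forall y : R,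
     D y -> Rabs (y - t) < delta ->
     norm (minus (minus (f y) (f t)) (scal (y - t) v)) <= eps * Rabs (y - t)).
Proof.
intros Dt; split.
- intros [_ H] eps.
  destruct (H t) with (eps := eps) as [delta Hd].
  { intros P [d HP]; exists d; intros y Hy _; now apply HP. }
  exists delta; intros y Dy Hy; exact (Hd y Hy Dy).
- intros H; split.
  { exact (@is_linear_scal_l R_AbsRing plane_module v). }
  intros x Hx.
  assert (Ext : x = t).
  { destruct (Req_dec x t) as [E | N]; [exact E |].
    assert (P : 0 < Rabs (t - x)) by (apply Rabs_pos_lt; lra).
    destruct (Hx (ball x (mkposreal _ P))) as [d Hd].
    { apply locally_ball. }
    specialize (Hd t (ball_center t d) Dt).
    apply (Rlt_irrefl (Rabs (t - x))) in Hd; contradiction. }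
  subst x; intros eps.
  destruct (H eps) as [delta Hd].
  exists delta; intros y Hy Dy; exact (Hd y Dy Hy).
Qed.

Lemma is_derive_in_ext (D : R -> Prop) (f g : R -> plane) (t : R) (v : plane) :
  D t -> (forall y, D y -> f y = g y) ->
  is_derive_in D f t v -> is_derive_in D g t v.
Proof.
intros Dt E H; apply is_derive_in_iff; [exact Dt |].
intros eps; destruct (proj1 (is_derive_in_iff D f t v Dt) H eps) as [d Hd].
exists d; intros y Dy; rewrite <- (E y Dy), <- (E t Dt); now apply Hd.
Qed.

Lemma is_derive_in_subset (D E : R -> Prop) (f : R -> plane) (t : R) (v : plane) :
  E t -> (forall y, E y -> D y) ->
  is_derive_in D f t v -> is_derive_in E f t v.
Proof.
intros Et Sub H; apply is_derive_in_iff; [exact Et |].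
intros eps; destruct (proj1 (is_derive_in_iff D f t v (Sub t Et)) H eps) as [d Hd].
exists d; intros y Ey; apply Hd; now apply Sub.
Qed.

Lemma is_derive_in_pair (D : R -> Prop) (f g : R -> R) (t a b : R) :
  D t -> is_derive f t a -> is_derive g t b ->
  is_derive_in D (fun y => (f y, g y)) t (a, b).
Proof.
intros Dt [_ Hf] [_ Hg]; apply is_derive_in_iff; [exact Dt |].
intros eps.
(* With [eps / 2] in each coordinate, the two squares add up to at most half the square allowed. *)
assert (Pe : 0 < eps / 2) by (destruct eps; simpl; lra).
destruct (Hf t (fun P HP => HP) (mkposreal _ Pe)) as [d1 H1].
destruct (Hg t (fun P HP => HP) (mkposreal _ Pe)) as [d2 H2].
assert (Pd : 0 < Rmin d1 d2) by (apply Rmin_pos; apply cond_pos).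
exists (mkposreal _ Pd); intros y _ Hy; simpl in Hy.
specialize (H1 y (Rlt_le_trans _ _ _ Hy (Rmin_l _ _))).
specialize (H2 y (Rlt_le_trans _ _ _ Hy (Rmin_r _ _))).
assert (Heps := cond_pos eps).
assert (Habs := Rabs_pos (y - t)).
change (Rabs (f y - f t - (y - t) * a) <= eps / 2 * Rabs (y - t)) in H1.
change (Rabs (g y - g t - (y - t) * b) <= eps / 2 * Rabs (y - t)) in H2.
apply norm_plane_le; [nra |].
change ((f y - f t - (y - t) * a) ^ 2 + (g y - g t - (y - t) * b) ^ 2
        <= (eps * Rabs (y - t)) ^ 2).
rewrite <- (pow2_abs (f y - _ - _)), <- (pow2_abs (g y - _ - _)).
assert (A1 := Rabs_pos (f y - f t - (y - t) * a)).
assert (A2 := Rabs_pos (g y - g t - (y - t) * b)).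
assert (B1 := pow_incr _ _ 2 (conj A1 H1)).
assert (B2 := pow_incr _ _ 2 (conj A2 H2)).
assert (0 <= (eps * Rabs (y - t)) ^ 2) by apply pow2_ge_0.
replace ((eps / 2 * Rabs (y - t)) ^ 2) with ((eps * Rabs (y - t)) ^ 2 / 4) in * by field.
lra.
Qed.

(** Supplies the points at which a derivative is tested, on whichever side of [t] the interval has
    room. *)
Lemma itv_other_point (a b t delta : R) :
  a < b -> itv a b t -> 0 < delta ->
  exists y, itv a b y /\ y <> t /\ Rabs (y - t) < delta.
Proof.
unfold itv; intros Hab Ht Hd.
destruct (Rlt_le_dec t b) as [L | L].
- set (h := Rmin ((b - t) / 2) (delta / 2)).
  assert (h <= (b - t) / 2) by apply Rmin_l.
  assert (h <= delta / 2) by apply Rmin_r.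
  assert (0 < h) by (apply Rmin_pos; lra).
  exists (t + h); repeat split; try lra.
  rewrite Rabs_pos_eq; lra.
- set (h := Rmin ((t - a) / 2) (delta / 2)).
  assert (h <= (t - a) / 2) by apply Rmin_l.
  assert (h <= delta / 2) by apply Rmin_r.
  assert (0 < h) by (apply Rmin_pos; lra).
  exists (t - h); repeat split; try lra.
  replace (t - h - t) with (- h) by ring.
  rewrite Rabs_Ropp, Rabs_pos_eq; lra.
Qed.

(** At nearby [y] other than [t], the linear approximation gives |y - t| * norm v <= (k + e) * |y -
    t|. This yields the curvature bound without computing any second derivative. *)
Lemma is_derive_in_norm_le (a b : R) (f : R -> plane) (t k : R) (v : plane) :
  a < b -> itv a b t ->
  (forall y, itv a b y -> norm (minus (f y) (f t)) <= k * Rabs (y - t)) ->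
  is_derive_in (itv a b) f t v -> norm v <= k.
Proof.
intros Hab Ht Lip H.
apply le_epsilon; intros e He.
destruct (proj1 (is_derive_in_iff _ f t v Ht) H (mkposreal e He)) as [d Hd].
destruct (itv_other_point a b t d Hab Ht (cond_pos d)) as [y [Iy [Ny Dy]]].
specialize (Hd y Iy Dy); specialize (Lip y Iy); simpl in Hd.
assert (P : 0 < Rabs (y - t)) by (apply Rabs_pos_lt; lra).
apply (Rmult_le_reg_l _ _ _ P).
assert (T : Rabs (y - t) * norm v = norm (scal (y - t) v)).
{ symmetry; apply (norm_plane_scal (y - t) v). }
rewrite T.
assert (T2 : Rabs (norm (minus (f y) (f t)) - norm (scal (y - t) v : plane)) <= norm (minus (minus (f y) (f t)) (scal (y - t) v))) by apply (@norm_triangle_inv R_AbsRing plane_module).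
apply Rabs_le_between in T2; lra.
Qed.

(** Both linear approximations hold at a common [y] other than [t], so (y - t) (v - w) has norm at
    most e |y - t| for every e > 0. *)
Lemma is_derive_in_unique (a b : R) (f : R -> plane) (t : R) (v w : plane) :
  a < b -> itv a b t ->
  is_derive_in (itv a b) f t v -> is_derive_in (itv a b) f t w -> v = w.
Proof.
intros Hab Ht Hv Hw.
assert (N : norm (minus v w) <= 0).
{ apply le_epsilon; intros e He.
  assert (He2 : 0 < e / 2) by lra.
  destruct (proj1 (is_derive_in_iff _ f t v Ht) Hv (mkposreal _ He2)) as [d1 H1].
  destruct (proj1 (is_derive_in_iff _ f t w Ht) Hw (mkposreal _ He2)) as [d2 H2].
  assert (Pd : 0 < Rmin d1 d2) by (apply Rmin_pos; apply cond_pos).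
  destruct (itv_other_point a b t _ Hab Ht Pd) as [y [Iy [Ny Dy]]].
  specialize (H1 y Iy (Rlt_le_trans _ _ _ Dy (Rmin_l _ _))).
  specialize (H2 y Iy (Rlt_le_trans _ _ _ Dy (Rmin_r _ _))).
  simpl in H1, H2.
  assert (P : 0 < Rabs (y - t)) by (apply Rabs_pos_lt; lra).
  apply (Rmult_le_reg_l _ _ _ P).
  assert (T : Rabs (y - t) * norm (minus v w) = norm (scal (y - t) (minus v w))).
  { symmetry; apply (norm_plane_scal (y - t) (minus v w)). }
  rewrite T.
  set (D := minus (f y) (f t)) in *.
  replace (scal (y - t) (minus v w))
    with (minus (minus D (scal (y - t) w)) (minus D (scal (y - t) v))).
  2: { unfold minus, plus, opp, scal, D; destruct v, w; simpl;
       unfold prod_plus, prod_opp, prod_scal; simpl;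
       unfold plus, opp, scal; simpl; unfold mult; simpl; f_equal; ring. }
  eapply Rle_trans; [apply (@norm_triangle R_AbsRing plane_module) |].
  rewrite (@norm_opp R_AbsRing plane_module); lra. }
assert (Z := norm_eq_zero (minus v w) (Rle_antisym _ _ N (@norm_ge_0 R_AbsRing plane_module _))).
apply (@plus_reg_r plane_module (opp w)).
rewrite (@plus_opp_r plane_module); exact Z.
Qed.

(** * Unit vectors as functions of the angle *)

Definition cis (theta : R) : plane := (cos theta, sin theta).

Lemma norm_cis (theta : R) : norm (cis theta) = 1.
Proof.
rewrite norm_plane; simpl fst; simpl snd.
assert (H := sin2_cos2 theta); unfold Rsqr in H.
replace (cos theta ^ 2 + sin theta ^ 2) with 1 by (rewrite <- H; ring).
apply sqrt_1.
Qed.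

Lemma Rabs_sin_le (x : R) : Rabs (sin x) <= Rabs x.
Proof.
destruct (MVT_gen sin 0 x cos) as [c [_ H]].
- intros; apply is_derive_sin.
- intros; apply continuity_sin.
- rewrite sin_0, !Rminus_0_r in H; rewrite H, Rabs_mult.
  assert (Rabs (cos c) <= 1) by (apply Rabs_le, COS_bound).
  assert (0 <= Rabs x) by apply Rabs_pos.
  nra.
Qed.

(** A chord is no longer than its arc: around the mean angle [m], with half-difference [h], the
    squared chord is 4 sin^2 h. *)
Lemma cis_lipschitz (x y : R) : norm (minus (cis x) (cis y)) <= Rabs (x - y).
Proof.
apply norm_plane_le; [apply Rabs_pos |].
change ((cos x - cos y) ^ 2 + (sin x - sin y) ^ 2 <= Rabs (x - y) ^ 2).
set (m := (x + y) / 2); set (h := (x - y) / 2).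
replace x with (m + h) at 1 2 by (unfold m, h; field).
replace y with (m - h) at 1 2 by (unfold m, h; field).
rewrite cos_plus, cos_minus, sin_plus, sin_minus, pow2_abs.
replace (x - y) with (2 * h) by (unfold h; field).
assert (H := Rabs_sin_le h).
assert (H2 := pow_incr _ _ 2 (conj (Rabs_pos _) H)); rewrite !pow2_abs in H2.
assert (T := sin2_cos2 m); unfold Rsqr in T.
replace (_ + _) with (4 * (sin m * sin m + cos m * cos m) * sin h ^ 2) by ring.
rewrite T; lra.
Qed.

(** * Words and their tangent angle *)

(* A word lists the pieces of a path as pairs (signed curvature, length). *)
Definition word : Type := list (R * R).

Fixpoint total (w : word) : R :=
  match w with
  | nil => 0
  | (_, l) :: w' => l + total w'
  end.

(** Meaningful for every real [t]: for admissible words the first piece is prolonged below 0, and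
    the angle is constant beyond [total w]. It is then continuous on the whole line, so its
    integrals need no domain conditions. *)
Fixpoint heading (w : word) (theta t : R) : R :=
  match w with
  | nil => theta
  | (k, l) :: w' =>
      if Rle_dec t l then theta + k * t else heading w' (theta + k * l) (t - l)
  end.

Fixpoint final_heading (w : word) (theta : R) : R :=
  match w with
  | nil => theta
  | (k, l) :: w' => final_heading w' (theta + k * l)
  end.

(** Strictly positive lengths make the junctions strictly increasing, as [piecewise_C1] requires. *)
Definition admissible (kappa : R) (w : word) : Prop :=
  List.Forall (fun p => Rabs (fst p) <= kappa /\ 0 < snd p) w.

Lemma total_ge_0 (kappa : R) (w : word) : admissible kappa w -> 0 <= total w.
Proof.
induction 1 as [| [k l] w [_ Hl] _ IH]; simpl in *; lra.
Qed.

Lemma heading_0 (kappa : R) (w : word) (theta : R) :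
  admissible kappa w -> heading w theta 0 = theta.
Proof.
destruct 1 as [| [k l] w [_ Hl] _]; simpl in *; [reflexivity |].
destruct (Rle_dec 0 l); lra.
Qed.

Lemma heading_total (kappa : R) (w : word) (theta : R) :
  admissible kappa w -> heading w theta (total w) = final_heading w theta.
Proof.
intros Hw; revert theta.
induction Hw as [| [k l] w [_ Hl] Hw IH]; intros theta; simpl in *; [reflexivity |].
destruct (Rle_dec (l + total w) l) as [L | L].
(* The first branch is taken at the end only if the remaining length is 0; both sides are then
   [theta + k * l]. *)
- assert (T := total_ge_0 _ _ Hw).
  assert (E : total w = 0) by lra.
  rewrite <- IH, E, (heading_0 kappa) by exact Hw; ring.
- rewrite <- IH; f_equal; ring.
Qed.

(** The definition gives the junction [t = l] to the first piece; the remaining word starts at the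
    same angle, so the second formula is valid there too. *)
Lemma heading_cons_right (kappa k l : R) (w : word) (theta t : R) :
  admissible kappa w -> l <= t ->
  heading ((k, l) :: w) theta t = heading w (theta + k * l) (t - l).
Proof.
intros Hw Ht; simpl; destruct (Rle_dec t l); [| reflexivity].
replace t with l by lra.
rewrite Rminus_diag, (heading_0 kappa) by exact Hw; reflexivity.
Qed.

Lemma heading_cons_left (k l : R) (w : word) (theta t : R) :
  t <= l -> heading ((k, l) :: w) theta t = theta + k * t.
Proof.
intros Ht; simpl; destruct (Rle_dec t l); [reflexivity | lra].
Qed.

(** The angle is piecewise linear with slopes bounded by [kappa]; an interval containing a junction
    is split there. *)
Lemma heading_lipschitz (kappa : R) (w : word) (theta t u : R) :
  0 <= kappa -> admissible kappa w ->
  Rabs (heading w theta t - heading w theta u) <= kappa * Rabs (t - u).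
Proof.
intros Hk Hw.
assert (Mono : forall theta t u, t <= u ->
  Rabs (heading w theta u - heading w theta t) <= kappa * (u - t)).
{ clear theta t u.
  induction Hw as [| [k l] w [Hkl Hl] Hw IH]; intros theta t u Htu.
  - simpl; rewrite Rminus_diag, Rabs_R0; nra.
  - simpl in Hkl, Hl.
    assert (Line : forall x y, x <= y ->
      Rabs (theta + k * y - (theta + k * x)) <= kappa * (y - x)).
    { intros x y Hxy.
      replace (theta + k * y - (theta + k * x)) with (k * (y - x)) by ring.
      rewrite Rabs_mult, (Rabs_pos_eq (y - x)) by lra.
      apply Rmult_le_compat_r; lra. }
    destruct (Rle_dec u l) as [Hu | Hu].
    { rewrite !heading_cons_left by lra; now apply Line. }
    apply Rnot_le_lt in Hu.
    rewrite (heading_cons_right kappa) with (t := u) by (assumption || lra).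
    destruct (Rle_dec l t) as [Ht | Ht].
    { rewrite (heading_cons_right kappa) by assumption.
      eapply Rle_trans; [apply IH; lra |]; apply Req_le; ring. }
    apply Rnot_le_lt in Ht.
    rewrite heading_cons_left by lra.
    specialize (IH (theta + k * l) 0 (u - l) ltac:(lra)).
    rewrite (heading_0 kappa) in IH by exact Hw.
    specialize (Line t l ltac:(lra)).
    replace (_ - _) with ((heading w (theta + k * l) (u - l) - (theta + k * l))
                          + (theta + k * l - (theta + k * t))) by ring.
    eapply Rle_trans; [apply Rabs_triang | lra]. }
destruct (Rle_dec u t) as [H | H].
- rewrite (Rabs_pos_eq (t - u)) by lra; now apply Mono.
- rewrite Rabs_minus_sym, (Rabs_minus_sym t), (Rabs_pos_eq (u - t)) by lra.
  apply Mono; lra.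
Qed.

Lemma heading_continuous (kappa : R) (w : word) (theta t : R) :
  0 < kappa -> admissible kappa w -> continuous (heading w theta) t.
Proof.
intros Hk Hw P [e He].
assert (Pd : 0 < e / kappa) by (apply Rdiv_lt_0_compat; [apply cond_pos | lra]).
exists (mkposreal _ Pd); intros y Hy; apply He.
change (Rabs (y - t) < e / kappa) in Hy.
change (Rabs (heading w theta y - heading w theta t) < e).
eapply Rle_lt_trans; [apply (heading_lipschitz kappa); auto; lra |].
apply (Rmult_lt_compat_l kappa) in Hy; [| lra].
replace (kappa * (e / kappa)) with (pos e) in Hy by (field; lra); exact Hy.
Qed.

Lemma cos_heading_continuous (kappa : R) (w : word) (theta t : R) :
  0 < kappa -> admissible kappa w ->
  continuous (fun t => cos (heading w theta t)) t.
Proof.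
intros; apply (continuous_comp (heading w theta) cos);
  [now apply (heading_continuous kappa) | apply continuous_cos].
Qed.

Lemma sin_heading_continuous (kappa : R) (w : word) (theta t : R) :
  0 < kappa -> admissible kappa w ->
  continuous (fun t => sin (heading w theta t)) t.
Proof.
intros; apply (continuous_comp (heading w theta) sin);
  [now apply (heading_continuous kappa) | apply continuous_sin].
Qed.

Lemma continuous_pair (f g : R -> R) (t : R) :
  continuous f t -> continuous g t ->
  continuous (fun y => (f y, g y) : plane) t.
Proof.
intros Hf Hg P [e He].
destruct (Hf (ball (f t) e) (locally_ball _ e)) as [d1 H1].
destruct (Hg (ball (g t) e) (locally_ball _ e)) as [d2 H2].
assert (Pd : 0 < Rmin d1 d2) by (apply Rmin_pos; apply cond_pos).
exists (mkposreal _ Pd); intros y Hy; apply He; split; simpl.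
- apply H1; eapply ball_le; [| exact Hy]; apply Rmin_l.
- apply H2; eapply ball_le; [| exact Hy]; apply Rmin_r.
Qed.

(** * Curves traced by words, and their membership in [Gamma] *)

(** Integrating the unit tangent gives C^1 regularity and arc-length parameterisation at once,
    whatever the pieces are. *)
Definition trace (w : word) (theta : R) (x : plane) (t : R) : plane :=
  (fst x + RInt (fun u => cos (heading w theta u)) 0 t,
   snd x + RInt (fun u => sin (heading w theta u)) 0 t).

Lemma is_derive_offset_RInt (f : R -> R) (c t : R) :
  (forall u, continuous f u) ->
  is_derive (fun t => c + RInt f 0 t) t (f t).
Proof.
intros Hf.
replace (f t) with (plus 0 (f t)) by apply Rplus_0_l.
apply (is_derive_plus (fun _ => c) (fun t => RInt f 0 t)).
- exact (@is_derive_const R_AbsRing R_NormedModule c t).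
- apply (is_derive_RInt f _ 0); [| apply Hf].
  apply filter_forall; intros u.
  apply (RInt_correct f), ex_RInt_continuous; intros; apply Hf.
Qed.

Lemma trace_C1 (kappa : R) (w : word) (theta : R) (x : plane) (a b : R) :
  0 < kappa -> admissible kappa w ->
  C1_with a b (trace w theta x) (fun t => cis (heading w theta t)).
Proof.
intros Hk Hw; split.
- intros t Ht; apply is_derive_in_pair; [exact Ht | |].
  + apply (is_derive_offset_RInt (fun u => cos (heading w theta u))); intros u.
    now apply (cos_heading_continuous kappa).
  + apply (is_derive_offset_RInt (fun u => sin (heading w theta u))); intros u.
    now apply (sin_heading_continuous kappa).
- apply continuous_on_forall; intros t _; apply continuous_pair.
  + now apply (cos_heading_continuous kappa).
  + now apply (sin_heading_continuous kappa).
Qed.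

Lemma piecewise_C1_cons (a c b : R) (f f' : R -> plane) :
  a < c -> C1_with a c f f' -> piecewise_C1 c b f -> piecewise_C1 a b f.
Proof.
intros Hac Hf (n & tau & H0 & Hn & Hp).
exists (S n), (fun i => match i with O => a | S j => tau j end).
repeat split; [exact Hn | |]; destruct i as [| i].
- now rewrite H0.
- apply Hp; lia.
- rewrite H0; now exists f'.
- apply Hp; lia.
Qed.

Lemma piecewise_C1_single (a b : R) (f f' : R -> plane) :
  a < b -> C1_with a b f f' -> piecewise_C1 a b f.
Proof.
intros Hab Hf.
exists O, (fun i => match i with O => a | S _ => b end).
repeat split; assert (i = O) by lia; subst i; [exact Hab | now exists f'].
Qed.

Lemma C1_with_ext (a b : R) (f g f' : R -> plane) :
  (forall t, itv a b t -> f t = g t) -> C1_with a b f f' -> C1_with a b g f'.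
Proof.
intros E [H1 H2]; split; [| exact H2].
intros t Ht; apply (is_derive_in_ext _ f); auto.
Qed.

Lemma cis_line_C1 (theta k a b : R) :
  C1_with a b (fun t => cis (theta + k * (t - a)))
    (fun t => (- k * sin (theta + k * (t - a)), k * cos (theta + k * (t - a)))).
Proof.
split.
- intros t Ht; apply is_derive_in_pair; [exact Ht | |];
    auto_derive; auto; unfold Rminus; ring.
- apply continuous_on_forall; intros t _; apply continuous_pair;
    apply (ex_derive_continuous (V := R_NormedModule)); auto_derive; auto.
Qed.

Lemma heading_piecewise_C1 (kappa : R) (w : word) (theta a : R) (f : R -> plane) :
  w <> nil -> admissible kappa w ->
  (forall t, itv a (a + total w) t -> f t = cis (heading w theta (t - a))) ->
  piecewise_C1 a (a + total w) f.
Proof.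
intros Nw Hw; revert theta a Nw.
induction Hw as [| [k l] w [Hkl Hl] Hw IH]; intros theta a Nw Hf; [easy |].
simpl in Hl.
assert (T := total_ge_0 _ _ Hw).
assert (First : C1_with a (a + l) f
  (fun t => (- k * sin (theta + k * (t - a)), k * cos (theta + k * (t - a))))).
{ apply (C1_with_ext _ _ (fun t => cis (theta + k * (t - a)))); [| apply cis_line_C1].
  intros t [Ht1 Ht2]; rewrite Hf by (split; simpl; lra).
  now rewrite heading_cons_left by lra. }
(* A single piece is the base case, because a subdivision in [piecewise_C1] has at least one
   piece. *)
destruct w as [| p w].
- simpl; rewrite Rplus_0_r; eapply piecewise_C1_single; [lra | exact First].
- eapply (piecewise_C1_cons a (a + l)); [lra | exact First |].
  change (total ((k, l) :: p :: w)) with (l + total (p :: w)).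
  rewrite <- Rplus_assoc.
  apply (IH (theta + k * l)); [easy |].
  intros t [Ht1 Ht2].
  rewrite Hf by (change (total ((k, l) :: p :: w)) with (l + total (p :: w)); split; lra).
  rewrite (heading_cons_right kappa) by (assumption || lra).
  f_equal; f_equal; ring.
Qed.

Lemma len_eq_dom_end (kappa : R) (X Y : tangent) (g : Gamma kappa X Y) :
  len g = dom_end g.
Proof.
unfold len.
assert (H := dom_end_pos _ _ _ g).
rewrite (RInt_ext _ (fun _ => 1)).
- rewrite RInt_const; unfold scal; simpl; unfold mult; simpl; ring.
- intros t; rewrite Rmin_left, Rmax_right by lra; intros Ht.
  apply path_arclength; split; lra.
Qed.

(** Reduces the construction of paths to finite lists. The velocity is the 1-Lipschitz [cis] after a
    [kappa]-Lipschitz angle, so the curvature bound needs no separate treatment of junctions. *)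
Lemma word_path (kappa : R) (w : word) (theta : R) (X Y : tangent) :
  0 < kappa -> w <> nil -> admissible kappa w ->
  snd X = cis theta ->
  Y = (trace w theta (fst X) (total w), cis (final_heading w theta)) ->
  exists g : Gamma kappa X Y, len g = total w.
Proof.
intros Hk Nw Hw HX HY.
assert (P : 0 < total w).
{ destruct Hw as [| [k l] w [_ Hl] Hw]; [easy |].
  assert (T := total_ge_0 _ _ Hw); simpl in *; lra. }
unshelve (eexists (Build_Gamma kappa X Y (total w) (trace w theta (fst X))
  (fun t => cis (heading w theta t)) P _ _ _ _ _ _ _ _)).
- now apply (trace_C1 kappa).
- rewrite <- (Rplus_0_l (total w)).
  apply (heading_piecewise_C1 kappa w theta); auto.
  intros t _; now rewrite Rminus_0_r.
- intros; apply norm_cis.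
- unfold trace; rewrite !RInt_point; destruct X as [[x1 x2] v].
  unfold zero; simpl; now rewrite !Rplus_0_r.
- cbv beta; now rewrite (heading_0 kappa).
- now rewrite HY.
- cbv beta; rewrite (heading_total kappa) by exact Hw; now rewrite HY.
- intros t v Ht; apply (is_derive_in_norm_le 0 (total w) _ t); auto.
  intros y _; eapply Rle_trans; [apply cis_lipschitz |].
  apply heading_lipschitz; auto; lra.
- apply len_eq_dom_end.
Qed.

(** * Endpoints computed piece by piece *)

(** The integral is cut at [l] and its second part translated by [l]. Taking [F] to be [cos] or
    [sin] serves both coordinates. *)
Lemma RInt_heading_cons (kappa k l : R) (w : word) (theta : R) (F : R -> R) :
  0 < kappa -> admissible kappa ((k, l) :: w) -> (forall u, continuous F u) ->
  RInt (fun u => F (heading ((k, l) :: w) theta u)) 0 (total ((k, l) :: w)) =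
  RInt (fun u => F (theta + k * u)) 0 l +
  RInt (fun u => F (heading w (theta + k * l) u)) 0 (total w).
Proof.
intros Hk Hkw HF.
inversion Hkw as [| p w' [_ Hl] Hw E]; subst; simpl in Hl.
assert (T := total_ge_0 _ _ Hw).
assert (Ex : forall v eta a b, admissible kappa v ->
  ex_RInt (fun u => F (heading v eta u)) a b).
{ intros v eta a b Hv; apply (ex_RInt_continuous (V := R_CompleteNormedModule)).
  intros z _; apply (continuous_comp (heading v eta) F); [| apply HF].
  now apply (heading_continuous kappa). }
rewrite <- (RInt_Chasles (V := R_CompleteNormedModule) _ 0 l) by now apply Ex.
change plus with Rplus; simpl total; f_equal.
- apply (RInt_ext (V := R_CompleteNormedModule)).
  intros u; rewrite Rmin_left, Rmax_right by lra; intros Hu.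
  now rewrite heading_cons_left by lra.
- assert (C := RInt_comp_lin (V := R_CompleteNormedModule)
    (fun u => F (heading w (theta + k * l) u)) 1 (- l) l (l + total w) (Ex _ _ _ _ Hw)).
  replace (1 * l + - l) with 0 in C by ring.
  replace (1 * (l + total w) + - l) with (total w) in C by ring.
  rewrite <- C.
  apply (RInt_ext (V := R_CompleteNormedModule)).
  intros u; rewrite Rmin_left, Rmax_right by lra; intros Hu.
  rewrite (heading_cons_right kappa) by (assumption || lra).
  change scal with Rmult; rewrite Rmult_1_l; do 2 f_equal; ring.
Qed.

Lemma trace_nil (theta : R) (x : plane) : trace nil theta x (total nil) = x.
Proof.
unfold trace; simpl total; rewrite !RInt_point; destruct x.
change (@zero R_CompleteNormedModule) with 0; simpl; now rewrite !Rplus_0_r.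
Qed.

(** Peels off an arc by moving the base point to its end. The new angle [theta'] is tied to the old
    one by an equation, so that it can be given in a form suited to later cancellation. *)
Lemma trace_cons_arc (kappa k l : R) (w : word) (theta theta' : R) (x : plane) :
  0 < kappa -> admissible kappa ((k, l) :: w) -> k <> 0 -> theta + k * l = theta' ->
  trace ((k, l) :: w) theta x (total ((k, l) :: w)) =
  trace w theta'
    (fst x + (sin theta' - sin theta) / k,
     snd x - (cos theta' - cos theta) / k) (total w).
Proof.
intros Hk Hw Hk0 <-; unfold trace.
rewrite (RInt_heading_cons kappa k l w theta cos) by
  (assumption || apply continuous_cos).
rewrite (RInt_heading_cons kappa k l w theta sin) by
  (assumption || apply continuous_sin).
assert (Ic : RInt (fun u => cos (theta + k * u)) 0 l =
             (sin (theta + k * l) - sin theta) / k).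
{ apply is_RInt_unique.
  replace (_ / k) with
    (minus (sin (theta + k * l) / k) (sin (theta + k * 0) / k)).
  2: { rewrite Rmult_0_r, Rplus_0_r; unfold minus, plus, opp; simpl; field; auto. }
  apply (is_RInt_derive (fun u => sin (theta + k * u) / k)); intros u _.
  - auto_derive; auto; field; auto.
  - apply (ex_derive_continuous (V := R_NormedModule)); auto_derive; auto. }
assert (Is : RInt (fun u => sin (theta + k * u)) 0 l =
             - ((cos (theta + k * l) - cos theta) / k)).
{ apply is_RInt_unique.
  replace (- _) with
    (minus (- cos (theta + k * l) / k) (- cos (theta + k * 0) / k)).
  2: { rewrite Rmult_0_r, Rplus_0_r; unfold minus, plus, opp; simpl; field; auto. }
  apply (is_RInt_derive (fun u => - cos (theta + k * u) / k)); intros u _.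
  - auto_derive; auto; field; auto.
  - apply (ex_derive_continuous (V := R_NormedModule)); auto_derive; auto. }
rewrite Ic, Is; simpl fst; simpl snd; f_equal; ring.
Qed.

Lemma trace_cons_segment (kappa l : R) (w : word) (theta : R) (x : plane) :
  0 < kappa -> admissible kappa ((0, l) :: w) ->
  trace ((0, l) :: w) theta x (total ((0, l) :: w)) =
  trace w theta (fst x + l * cos theta, snd x + l * sin theta) (total w).
Proof.
intros Hk Hw; unfold trace.
rewrite (RInt_heading_cons kappa 0 l w theta cos) by
  (assumption || apply continuous_cos).
rewrite (RInt_heading_cons kappa 0 l w theta sin) by
  (assumption || apply continuous_sin).
assert (I : forall F : R -> R, RInt (fun u => F (theta + 0 * u)) 0 l = l * F theta).
{ intros F; rewrite (RInt_ext (V := R_CompleteNormedModule) _ (fun _ => F theta)).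
  - rewrite RInt_const; change ((l - 0) * F theta = l * F theta); ring.
  - intros u _; f_equal; ring. }
rewrite !I, Rmult_0_l, Rplus_0_r; simpl fst; simpl snd; f_equal; ring.
Qed.

(** * Position and tangent along a circular arc *)

Lemma turn_sign_cases (d : turn) : turn_sign d = 1 \/ turn_sign d = -1.
Proof. destruct d; simpl; auto. Qed.

Lemma turn_sign_opp (d : turn) : turn_sign (opp_turn d) = - turn_sign d.
Proof. destruct d; simpl; ring. Qed.

(** A tangent vector determines its angle only modulo 2 PI, so successive arcs are matched through
    [cis] rather than through angles. *)
Lemma cis_inj_shift (x y h : R) : cis x = cis y -> cis (x + h) = cis (y + h).
Proof.
unfold cis; intros E; injection E as Ec Es.
now rewrite !cos_plus, !sin_plus, Ec, Es.
Qed.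

(** Passes from the polar angle about the centre to the tangent angle, which differs by a quarter
    turn in the turning direction. Uniqueness of the derivative identifies [v]. *)
Lemma arc_state (kappa : R) (d : turn) (f v : R -> plane) (a eta : R) :
  0 < kappa -> 0 < eta -> is_arc kappa d f a eta ->
  (forall t, itv a (a + eta / kappa) t ->
     is_derive_in (itv a (a + eta / kappa)) f t (v t)) ->
  exists (c : plane) (theta : R), forall t, itv a (a + eta / kappa) t ->
    let psi := theta + turn_sign d * (kappa * (t - a)) in
    v t = cis psi /\
    f t = (fst c + sin psi / (turn_sign d * kappa),
           snd c - cos psi / (turn_sign d * kappa)).
Proof.
intros Hk He (c & phi & Hf) Hv.
assert (P : 0 < eta / kappa) by now apply Rdiv_lt_0_compat.
exists c, (phi + turn_sign d * (PI / 2)); intros t Ht psi.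
assert (Q : cis (turn_sign d * (PI / 2)) = (0, turn_sign d)).
{ unfold cis; destruct (turn_sign_cases d) as [-> | ->].
  - now rewrite Rmult_1_l, cos_PI2, sin_PI2.
  - replace (-1 * (PI / 2)) with (- (PI / 2)) by ring.
    rewrite cos_neg, sin_neg, cos_PI2, sin_PI2; f_equal; ring. }
injection Q as Qc Qs.
set (chi := phi + turn_sign d * (kappa * (t - a))).
assert (Epsi : psi = chi + turn_sign d * (PI / 2)) by (unfold psi, chi; ring).
assert (Ec : cos psi = - turn_sign d * sin chi)
  by (rewrite Epsi, cos_plus, Qc, Qs; ring).
assert (Es : sin psi = turn_sign d * cos chi)
  by (rewrite Epsi, sin_plus, Qc, Qs; ring).
split.
- apply (is_derive_in_unique a (a + eta / kappa) f t); [lra | exact Ht | now apply Hv |].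
  apply (is_derive_in_ext _
    (fun t => (fst c + / kappa * cos (phi + turn_sign d * (kappa * (t - a))),
               snd c + / kappa * sin (phi + turn_sign d * (kappa * (t - a)))))).
  + exact Ht.
  + intros y Hy; now rewrite Hf.
  + unfold cis; rewrite Ec, Es; unfold chi.
    apply is_derive_in_pair; [exact Ht | |]; auto_derive; auto; unfold Rminus;
      field; lra.
- rewrite Hf, Ec, Es by exact Ht; fold chi.
  destruct (turn_sign_cases d) as [-> | ->]; f_equal; field; lra.
Qed.

(** Here [theta] is inherited from the preceding arc and may differ from the angle intrinsic to this
    arc by a multiple of 2 PI. The form allows arcs to be chained. *)
Lemma arc_end (kappa : R) (d : turn) (f v : R -> plane) (a eta theta : R) :
  0 < kappa -> 0 < eta -> is_arc kappa d f a eta ->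
  (forall t, itv a (a + eta / kappa) t ->
     is_derive_in (itv a (a + eta / kappa)) f t (v t)) ->
  v a = cis theta ->
  let k := turn_sign d * kappa in
  v (a + eta / kappa) = cis (theta + k * (eta / kappa)) /\
  f (a + eta / kappa) =
    (fst (f a) + (sin (theta + k * (eta / kappa)) - sin theta) / k,
     snd (f a) - (cos (theta + k * (eta / kappa)) - cos theta) / k).
Proof.
intros Hk He Harc Hv Ha k.
assert (P : 0 < eta / kappa) by now apply Rdiv_lt_0_compat.
assert (K : k <> 0).
{ unfold k; destruct (turn_sign_cases d) as [-> | ->]; lra. }
destruct (arc_state kappa d f v a eta Hk He Harc Hv) as (c & theta0 & H).
destruct (H a ltac:(split; lra)) as [Va Fa].
destruct (H (a + eta / kappa) ltac:(split; lra)) as [Vb Fb].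
fold k in Fa, Fb.
rewrite Rminus_diag, Rmult_0_r, Rmult_0_r, Rplus_0_r in Va, Fa.
rewrite Ha in Va.
replace (turn_sign d * (kappa * (a + eta / kappa - a))) with (k * (eta / kappa))
  in Vb, Fb by (unfold k; field; lra).
assert (E := cis_inj_shift _ _ (k * (eta / kappa)) Va).
rewrite <- E in Vb; split; [exact Vb |].
unfold cis in E, Va; injection E as Ec Es; injection Va as Ec0 Es0.
rewrite Fb, Fa, Ec, Es, Ec0, Es0; simpl fst; simpl snd; f_equal; field; exact K.
Qed.

(** * Shortening and lengthening a three-arc word *)

Ltac word_side :=
  solve [ assumption
        | repeat apply List.Forall_cons; try apply List.Forall_nil;
          simpl; rewrite ?Rabs_R0; lra
        | repeat match goal with z := _ : R |- _ => subst z end; field; try lra ].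

(** The final angles agree as real numbers, not only modulo 2 PI. *)
Definition same_end (w w' : word) : Prop :=
  forall theta : R, final_heading w theta = final_heading w' theta /\
    forall x : plane, trace w theta x (total w) = trace w' theta x (total w').

(** Each cut straddles a junction and removes opposite turnings, so the angles at the midpoint of
    the middle arc and at the end are kept. By symmetry the change of displacement is parallel to
    the tangent at that midpoint, and one segment there compensates it. *)
Lemma ex_shorter_word (kappa k p q r : R) :
  0 < kappa -> Rabs k = kappa -> 0 < p -> 0 < q -> 0 < r -> kappa * q <= PI ->
  exists w : word, admissible kappa w /\ w <> nil /\
    same_end w [(k, p); (- k, q); (k, r)] /\ total w < p + q + r.
Proof.
intros Hk Rk Hp Hq Hr Hq2.
assert (Rk' : Rabs (- k) = kappa) by now rewrite Rabs_Ropp.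
assert (K : k <> 0) by (intros ->; rewrite Rabs_R0 in Rk; lra).
(* Half the minimum leaves every shortened arc a positive length. *)
set (a := Rmin p (Rmin r (q / 2)) / 2).
assert (A : 0 < Rmin p (Rmin r (q / 2)) <= p /\ Rmin p (Rmin r (q / 2)) <= r
            /\ Rmin p (Rmin r (q / 2)) <= q / 2).
{ repeat split.
  - repeat apply Rmin_pos; lra.
  - apply Rmin_l.
  - eapply Rle_trans; [apply Rmin_r | apply Rmin_l].
  - eapply Rle_trans; [apply Rmin_r | apply Rmin_r]. }
set (d := 4 / kappa * (sin (kappa * (q / 2)) - sin (kappa * (q / 2 - a)))).
assert (Ha : 0 < a < p /\ a < r /\ a < q / 2) by (unfold a; lra).
(* As [sin] is odd, the formula for [d] also holds with the signed curvature [k], which covers both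
   turning directions. *)
assert (Kd : k * d = 4 * (sin (k * (q / 2)) - sin (k * (q / 2 - a)))).
{ unfold d; revert Rk; unfold Rabs; destruct (Rcase_abs k); intros Rk.
  - replace k with (- kappa) by lra.
    rewrite !Ropp_mult_distr_l_reverse, !sin_neg; field; lra.
  - rewrite Rk; field; lra. }
assert (Hd : 0 < d < 4 * a).
{ assert (B : 0 < kappa * a < kappa * (q / 2))
    by (split; [nra | apply Rmult_lt_compat_l; lra]).
  (* The difference of sines is written as a product. Its cosine is positive because kappa (q - a) /
     2 < PI / 2; then c <= 2 and sin x < x give d < 4a. *)
  set (c := 2 * cos (kappa * (q - a) / 2)).
  assert (D : d = 4 / kappa * (c * sin (kappa * a / 2))).
  { unfold d, c; rewrite form4; do 4 f_equal; field. }
  assert (S := sin_gt_0 (kappa * a / 2) ltac:(lra) ltac:(lra)).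
  assert (S' := sin_lt_x (kappa * a / 2) ltac:(lra)).
  assert (C := cos_gt_0 (kappa * (q - a) / 2) ltac:(nra) ltac:(nra)).
  assert (C' := COS_bound (kappa * (q - a) / 2)).
  assert (0 < 4 / kappa) by (apply Rdiv_lt_0_compat; lra).
  rewrite D; split.
  - repeat apply Rmult_lt_0_compat; unfold c; lra.
  - replace (4 * a) with (4 / kappa * (kappa * a)) by (field; lra).
    apply Rmult_lt_compat_l; unfold c; nra. }
exists [(k, p - a); (- k, q / 2 - a); (0, d); (- k, q / 2 - a); (k, r - a)].
split; [| split; [easy | split]].
- repeat apply List.Forall_cons; try apply List.Forall_nil;
    simpl; rewrite ?Rabs_R0; lra.
- intros theta; split; [simpl; field |]; intros x.
  (* [m] is the angle at the midpoint of the middle arc and [psi] the final one; expanding around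
     [m] shows the symmetry. *)
  set (m := theta + k * (p - q / 2)).
  set (psi := theta + k * (p - q + r)).
  rewrite (trace_cons_arc kappa k (p - a) _ theta (m + (k * (q / 2) - k * a)))
    by word_side.
  rewrite (trace_cons_arc kappa (- k) (q / 2 - a) _ _ m) by word_side.
  rewrite (trace_cons_segment kappa) by word_side.
  rewrite (trace_cons_arc kappa (- k) (q / 2 - a) _ _ (m - (k * (q / 2) - k * a)))
    by word_side.
  rewrite (trace_cons_arc kappa k (r - a) _ _ psi) by word_side.
  rewrite trace_nil.
  rewrite (trace_cons_arc kappa k p _ theta (m + k * (q / 2))) by word_side.
  rewrite (trace_cons_arc kappa (- k) q _ _ (m - k * (q / 2))) by word_side.
  rewrite (trace_cons_arc kappa k r _ _ psi) by word_side.
  rewrite trace_nil; simpl fst; simpl snd.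
  replace (k * (q / 2 - a)) with (k * (q / 2) - k * a) in Kd by ring.
  apply (f_equal (fun z => z / k)) in Kd.
  replace (k * d / k) with d in Kd by (field; exact K).
  rewrite Kd, !cos_plus, !sin_plus, !(cos_minus m), !(sin_minus m).
  f_equal; field; exact K.
- simpl; lra.
Qed.

(** The two segments have opposite directions and equal lengths, so their displacements cancel, and
    they do not turn. *)
Lemma ex_longer_word (kappa k p q r e : R) :
  0 < kappa -> Rabs k = kappa -> 0 < p -> 0 < q -> 0 < r -> PI < kappa * q ->
  0 < e ->
  exists w : word, admissible kappa w /\ w <> nil /\
    same_end w [(k, p); (- k, q); (k, r)] /\ total w = p + q + r + e.
Proof.
intros Hk Rk Hp Hq Hr Hq2 He.
assert (Rk' : Rabs (- k) = kappa) by now rewrite Rabs_Ropp.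
assert (K : k <> 0) by (intros ->; rewrite Rabs_R0 in Rk; lra).
(* The length of a half turn, measured from the start of the middle arc. Strictness of
   [PI < kappa * q] makes the remainder [q - h] positive. *)
set (h := PI / kappa).
assert (Hh : 0 < h < q).
{ unfold h; assert (P := PI_RGT_0); split; [now apply Rdiv_lt_0_compat |].
  apply Rlt_div_l; lra. }
assert (Opp : forall x, cis (x - k * h) = (- cos x, - sin x)).
{ intros x; unfold cis; rewrite cos_minus, sin_minus.
  assert (Ek : k * h = PI \/ k * h = - PI).
  { revert Rk; unfold h, Rabs; destruct (Rcase_abs k); intros Rk.
    - right; replace k with (- kappa) by lra; field; lra.
    - left; rewrite Rk; field; lra. }
  destruct Ek as [-> | ->]; rewrite ?cos_neg, ?sin_neg, cos_PI, sin_PI; f_equal; ring. }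
exists [(k, p); (0, e / 2); (- k, h); (0, e / 2); (- k, q - h); (k, r)].
split; [| split; [easy | split]].
- repeat apply List.Forall_cons; try apply List.Forall_nil;
    simpl; rewrite ?Rabs_R0; lra.
- intros theta; split; [simpl; field |]; intros x.
  set (m := theta + k * p).
  set (n := m - k * q).
  set (psi := theta + k * (p - q + r)).
  rewrite (trace_cons_arc kappa k p _ theta m) by word_side.
  rewrite (trace_cons_segment kappa) by word_side.
  rewrite (trace_cons_arc kappa (- k) h _ _ (m - k * h)) by word_side.
  rewrite (trace_cons_segment kappa) by word_side.
  rewrite (trace_cons_arc kappa (- k) (q - h) _ _ n) by word_side.
  rewrite (trace_cons_arc kappa k r _ _ psi) by word_side.
  rewrite trace_nil.
  rewrite (trace_cons_arc kappa k p _ theta m) by word_side.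
  rewrite (trace_cons_arc kappa (- k) q _ _ n) by word_side.
  rewrite (trace_cons_arc kappa k r _ _ psi) by word_side.
  rewrite trace_nil; simpl fst; simpl snd.
  specialize (Opp m); unfold cis in Opp; injection Opp as -> ->.
  f_equal; field; exact K.
- simpl; field.
Qed.

(** * From the geometric pattern to a word, and conclusion *)

(** The initial angle is read off the first arc, and [arc_end] is then applied along the three
    arcs. *)
Lemma CCC_word (kappa : R) (X Y : tangent) (g : Gamma kappa X Y) (eta zeta xi : R) :
  0 < kappa -> CCC g eta zeta xi ->
  exists k theta : R, Rabs k = kappa /\ snd X = cis theta /\
    let w := [(k, eta / kappa); (- k, zeta / kappa); (k, xi / kappa)] in
    Y = (trace w theta (fst X) (total w), cis (final_heading w theta)).
Proof.
intros Hk (He & Hz & Hx & Hend & d & A1 & A2 & A3).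
assert (P1 : 0 < eta / kappa) by now apply Rdiv_lt_0_compat.
assert (P2 : 0 < zeta / kappa) by now apply Rdiv_lt_0_compat.
assert (P3 : 0 < xi / kappa) by now apply Rdiv_lt_0_compat.
replace ((eta + zeta + xi) / kappa) with (eta / kappa + zeta / kappa + xi / kappa)
  in Hend by (field; lra).
replace ((eta + zeta) / kappa) with (eta / kappa + zeta / kappa) in A3 by (field; lra).
(* The same [vel] serves as derivative on each arc, so consecutive arcs share their tangent at a
   junction. *)
assert (Sub : forall a b, 0 <= a -> a <= b -> b <= dom_end g -> forall t, itv a b t ->
  is_derive_in (itv a b) (path g) t (vel g t)).
{ intros a b Ha Hab Hb t Ht.
  apply (is_derive_in_subset (itv 0 (dom_end g))); [exact Ht | |].
  - intros y [H1 H2]; split; lra.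
  - destruct Ht; apply (path_C1 _ _ _ g); split; lra. }
assert (D1 := Sub 0 (0 + eta / kappa) ltac:(lra) ltac:(lra) ltac:(lra)).
assert (D2 := Sub (eta / kappa) (eta / kappa + zeta / kappa)
                ltac:(lra) ltac:(lra) ltac:(lra)).
assert (D3 := Sub (eta / kappa + zeta / kappa) (eta / kappa + zeta / kappa + xi / kappa)
                ltac:(lra) ltac:(lra) ltac:(lra)).
set (k := turn_sign d * kappa).
assert (Rk : Rabs k = kappa).
{ unfold k; destruct (turn_sign_cases d) as [-> | ->].
  - rewrite Rmult_1_l; apply Rabs_pos_eq; lra.
  - rewrite Rabs_left; lra. }
assert (Rk' : Rabs (- k) = kappa) by now rewrite Rabs_Ropp.
assert (K : k <> 0) by (intros E; rewrite E, Rabs_R0 in Rk; lra).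
destruct (arc_state _ _ _ _ _ _ Hk He A1 D1) as (c & theta & H0).
destruct (H0 0 ltac:(split; lra)) as [V0 _].
rewrite Rminus_diag, Rmult_0_r, Rmult_0_r, Rplus_0_r in V0.
destruct (arc_end _ _ _ _ _ _ _ Hk He A1 D1 V0) as [V1 F1].
rewrite Rplus_0_l in V1, F1.
destruct (arc_end _ _ _ _ _ _ _ Hk Hz A2 D2 V1) as [V2 F2].
destruct (arc_end _ _ _ _ _ _ _ Hk Hx A3 D3 V2) as [V3 F3].
rewrite turn_sign_opp in V2, F2, V3, F3.
replace (- turn_sign d * kappa) with (- k) in V2, F2, V3, F3 by (unfold k; ring).
fold k in V1, F1, V2, F2, V3, F3.
rewrite (path_start _ _ _ g) in F1.
rewrite F1 in F2; rewrite F2 in F3.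
rewrite <- Hend, (path_end _ _ _ g) in F3.
rewrite <- Hend, (vel_end _ _ _ g) in V3.
exists k, theta; split; [exact Rk |]; split.
{ rewrite <- V0; symmetry; apply vel_start. }
intros w; unfold w.
(* Choosing [eq_refl] leaves the angles in exactly the form produced by [arc_end]. *)
rewrite (trace_cons_arc kappa k (eta / kappa) _ theta _) with (4 := eq_refl)
  by word_side.
rewrite (trace_cons_arc kappa (- k) (zeta / kappa) _ _ _) with (4 := eq_refl)
  by word_side.
rewrite (trace_cons_arc kappa k (xi / kappa) _ _ _) with (4 := eq_refl)
  by word_side.
rewrite trace_nil; rewrite (surjective_pairing Y); f_equal; assumption.
Qed.

Theorem proposition1 (kappa : R) (kappa_pos : 0 < kappa) (X Y : tangent)
  (hX : oriented_point X) (hY : oriented_point Y) (hXY : X <> Y)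
  (gm : Gamma kappa X Y) (gm_shortest : shortest gm)
  (eta zeta xi : R) (gm_CCC : CCC gm eta zeta xi)
  (s : R) (hs : len gm <= s) :
  exists g : Gamma kappa X Y, s = len g.
Proof.
destruct (CCC_word _ _ _ _ _ _ _ kappa_pos gm_CCC) as (k & theta & Rk & EX & EY).
assert (L := len_eq_dom_end _ _ _ gm).
destruct gm_CCC as (He & Hz & Hx & Hend & _).
assert (P1 : 0 < eta / kappa) by now apply Rdiv_lt_0_compat.
assert (P2 : 0 < zeta / kappa) by now apply Rdiv_lt_0_compat.
assert (P3 : 0 < xi / kappa) by now apply Rdiv_lt_0_compat.
replace ((eta + zeta + xi) / kappa) with (eta / kappa + zeta / kappa + xi / kappa)
  in Hend by (field; lra).
assert (Realize : forall w, admissible kappa w -> w <> nil ->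
  same_end w [(k, eta / kappa); (- k, zeta / kappa); (k, xi / kappa)] ->
  exists g : Gamma kappa X Y, len g = total w).
{ intros w Hw Nw E; destruct (E theta) as [E1 E2].
  apply (word_path kappa w theta); auto.
  rewrite E1, E2; exact EY. }
destruct (Rle_lt_dec (kappa * (zeta / kappa)) PI) as [Hpi | Hpi].
- exfalso.
  destruct (ex_shorter_word kappa k _ _ _ kappa_pos Rk P1 P2 P3 Hpi)
    as (w & Hw & Nw & E & Lt).
  destruct (Realize w Hw Nw E) as [g Hg].
  assert (H := gm_shortest g); lra.
(* For [s = len gm] the path [gm] itself serves, since the inserted segments must have positive
   length. *)
- destruct (Rle_lt_or_eq_dec _ _ hs) as [Hs | Hs]; [| now exists gm].
  destruct (ex_longer_word kappa k _ _ _ (s - len gm) kappa_pos Rk P1 P2 P3 Hpi)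
    as (w & Hw & Nw & E & Eq); [lra |].
  destruct (Realize w Hw Nw E) as [g Hg].
  exists g; lra.
Qed.
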